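(* Let $G$ be a finitely generated nilpotent group of class $2$. If $G$ has a c-small element, then the largest ring of scalars of $G$ is (isomorphic to) $\mathbb{Z}$ and it is e-interpretable in $G$.
   Context: An element $g$ of a group $G$ is c-small if its centralizer satisfies $C_G(g)=\{g^t z\mid t\in\mathbb{Z},\ z\in Z(G)\}$ and $C_G(g)/Z(G)$ is infinite cyclic. Let $A,B$ be abelian groups and $f:A\times A\to B$ a bilinear map. $f$ is non-degenerate if $f(a,x)=0$ for all $x\in A$ implies $a=0$, and similarly for $f(x,a)$; $f$ is full if its image generates $B$. An associative commutative unitary ring $R$ is a ring of scalars of $f$ if there are faithful actions of $R$ on $A$ and on $B$ turning them into $R$-modules such that $f(\alpha x,y)=f(x,\alpha y)=\alpha f(x,y)$ for all $\alpha\in R$, $x,y\in A$. Rings of scalars are regarded as subrings of $\mathrm{End}(A)$ via their faithful action on $A$. $R$ is the largest ring of scalars of $f$ if every other ring of scalars $R'$ of $f$ satisfies $R'\leq R$ as subrings of $\mathrm{End}(A)$; it exists and is unique when $f$ is full and non-degenerate, and is denoted $R(f)$. For a nilpotent group $G$ of class $2$, the largest ring of scalars of $G$ is $R(f)$ for the full non-degenerate bilinear map $f:G/Z(G)\times G/Z(G)\to G'$, $(xZ(G),yZ(G))\mapsto[x,y]$. An equation in a group $G$ is an equality of two terms (group words) built from variables and arbitrary elements of $G$. A subset $X\subseteq G^m$ is e-definable in $G$ if there is a finite system $\Sigma(\mathbf{x},\mathbf{y})$ of equations with coefficients in $G$ such that for every $\mathbf{a}\in G^m$ one has $\mathbf{a}\in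 X$ if and only if $\Sigma(\mathbf{a},\mathbf{y})$ has a solution $\mathbf{y}$ in $G$. A ring $R$ is e-interpretable in $G$ if for some $m$ there are an e-definable set $X\subseteq G^m$ and a surjective map $\phi:X\to R$ such that the preimages under $\phi$ of the equality relation of $R$ and of the graphs of the addition and multiplication of $R$ are e-definable in $G$. *)

(* Defs.v *)
From HB Require Import structures.
From mathcomp Require Import all_boot all_algebra generic_quotient.
From mathcomp Require Import boolp classical_sets functions.

Set Implicit Arguments.
Unset Strict Implicit.
Unset Printing Implicit Defensive.

Import GRing.Theory.

Local Open Scope classical_set_scope.
Local Open Scope group_scope.

(* Possibly infinite groups are [groupType]s, and their subsets are classical
   sets, so that membership need not be decidable. *)

Definition zexpg (G : groupType) (x : G) (t : int) : G :=
  match t with Posz n => x ^+ n | Negz n => x ^- n.+1 end.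

Definition is_subgroup (G : groupType) (H : set G) : Prop :=
  H 1 /\ forall x y, H x -> H y -> H (x / y).

Definition gen (G : groupType) (S : set G) : set G := smallest (@is_subgroup G) S.

Definition finitely_generated (G : groupType) : Prop :=
  exists s : seq G, gen [set` s] = [set: G].

Definition center (G : groupType) : set G := [set z | forall x, commute z x].
Arguments center : clear implicits.

Definition centralizer (G : groupType) (g : G) : set G := [set x | commute x g].

(* The subgroup generated by the commutators [~ x, y], x in H, y in K. *)
Definition commutator (G : groupType) (H K : set G) : set G :=
  gen [set [~ x, y] | x in H & y in K].

(* gamma_(n + 1) in the usual numbering, where gamma_1 = G. *)
Definition lower_central (G : groupType) (n : nat) : set G :=
  iter n (fun H => commutator H [set: G]) [set: G].
Arguments lower_central : clear implicits.

Definition nilpotent_of_class (G : groupType) (c : nat) : Prop :=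
  lower_central G c = [set 1] /\
  forall k, (k < c)%N -> lower_central G k <> [set 1].

Definition derived (G : groupType) : set G := commutator [set: G] [set: G].
Arguments derived : clear implicits.

Definition infinite_cyclic (G : groupType) (H : set G) : Prop :=
  exists2 h, H = range (zexpg h) & injective (zexpg h).

Section Subgroups.
Variable G : groupType.

Lemma is_subgroup_gen (S : set G) : is_subgroup (gen S).
Proof.
split=> [H [[H1 _] _] //|x y hx hy H hH].
by case: (hH) => -[_ Hd] _; apply: Hd; [apply: hx | apply: hy].
Qed.

Lemma sub_gen (S : set G) : S `<=` gen S.
Proof. by move=> x Sx H [_]; apply. Qed.

Lemma gen_min (S H : set G) : is_subgroup H -> S `<=` H -> gen S `<=` H.
Proof. by move=> hH SH x; apply. Qed.

Lemma is_subgroup_center : is_subgroup (center G).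
Proof.
split=> [x|x y cx cy u]; first by rewrite /commute mul1g mulg1.
by apply: commute_sym; apply: commuteM; [|apply: commuteV];
  apply: commute_sym; [apply: cx | apply: cy].
Qed.

Lemma centerM (x y : G) : center G x -> center G y -> center G (x * y).
Proof.
have [c1 cdiv] := is_subgroup_center.
move=> cx cy; rewrite -[y]invgK; apply: (cdiv) => //.
by rewrite -[y^-1]mul1g; apply: (cdiv).
Qed.

Lemma centerV (x : G) : center G x -> center G x^-1.
Proof.
by move=> cx; have [c1 cdiv] := is_subgroup_center; rewrite -[x^-1]mul1g; apply: (cdiv).
Qed.

End Subgroups.

Section CentralQuotient.
Variable G : groupType.

Definition eqmodZ (x y : G) : bool := `[< center G (x^-1 * y) >].

Lemma eqmodZP x y : reflect (center G (x^-1 * y)) (eqmodZ x y).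
Proof. exact: asboolP. Qed.

Lemma eqmodZ_refl : reflexive eqmodZ.
Proof. by move=> x; apply/eqmodZP; rewrite mulVg; case: (is_subgroup_center G). Qed.

Lemma eqmodZ_sym : symmetric eqmodZ.
Proof.
by move=> x y; apply/eqmodZP/eqmodZP => /centerV; rewrite invgM invgK.
Qed.

Lemma eqmodZ_trans : transitive eqmodZ.
Proof.
move=> y x z /eqmodZP h1 /eqmodZP h2; apply/eqmodZP.
by rewrite -(mulgK y x^-1) -mulgA; apply: centerM.
Qed.

Canonical eqmodZ_equiv := EquivRel eqmodZ eqmodZ_refl eqmodZ_sym eqmodZ_trans.

Definition quotZ := {eq_quot eqmodZ_equiv}%qT.
HB.instance Definition _ := EqQuotient.on quotZ.
HB.instance Definition _ := Choice.on quotZ.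

Definition cosetZ (x : G) : quotZ := (\pi_quotZ x)%qT.

Lemma cosetZ_eq x y : cosetZ x = cosetZ y <-> center G (x^-1 * y).
Proof. by split=> [/eqmodP/eqmodZP|/eqmodZP/eqmodP]. Qed.

Lemma cosetZ_repr u : cosetZ (repr u) = u.
Proof. exact: reprK. Qed.

Definition quotZ_mul (u v : quotZ) : quotZ := cosetZ (repr u * repr v).
Definition quotZ_one : quotZ := cosetZ 1.
Definition quotZ_inv (u : quotZ) : quotZ := cosetZ (repr u)^-1.

Lemma cosetZM x y : quotZ_mul (cosetZ x) (cosetZ y) = cosetZ (x * y).
Proof.
rewrite /quotZ_mul; set x' := repr _; set y' := repr _.
have /cosetZ_eq cx : cosetZ x' = cosetZ x by exact: cosetZ_repr.
have /cosetZ_eq cy : cosetZ y' = cosetZ y by exact: cosetZ_repr.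
apply/cosetZ_eq; rewrite invgM -mulgA (mulgA x'^-1) (cx y) mulgA.
exact: centerM.
Qed.

Lemma cosetZV x : quotZ_inv (cosetZ x) = cosetZ x^-1.
Proof.
rewrite /quotZ_inv; set x' := repr _.
have /esym/cosetZ_eq cx : cosetZ x' = cosetZ x by exact: cosetZ_repr.
by apply/cosetZ_eq; rewrite invgK -[x'](mulVKg x) -(cx x) mulgK.
Qed.


Lemma quotZ_mulA : associative quotZ_mul.
Proof.
move=> u v w; rewrite -[u]cosetZ_repr -[v]cosetZ_repr -[w]cosetZ_repr.
by rewrite !cosetZM mulgA.
Qed.

Lemma quotZ_mul1 : left_id quotZ_one quotZ_mul.
Proof. by move=> u; rewrite -[u]cosetZ_repr cosetZM mul1g. Qed.

Lemma quotZ_1mul : right_id quotZ_one quotZ_mul.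
Proof. by move=> u; rewrite -[u]cosetZ_repr cosetZM mulg1. Qed.

Lemma quotZ_mulV : left_inverse quotZ_one quotZ_inv quotZ_mul.
Proof. by move=> u; rewrite -[u]cosetZ_repr cosetZV cosetZM mulVg. Qed.

Lemma quotZ_Vmul : right_inverse quotZ_one quotZ_inv quotZ_mul.
Proof. by move=> u; rewrite -[u]cosetZ_repr cosetZV cosetZM mulgV. Qed.

HB.instance Definition _ := isGroup.Build quotZ
  quotZ_mulA quotZ_mul1 quotZ_1mul quotZ_mulV quotZ_Vmul.

Lemma cosetZ_mul x y : cosetZ x * cosetZ y = cosetZ (x * y).
Proof. exact: cosetZM. Qed.

Lemma cosetZ_inv x : (cosetZ x)^-1 = cosetZ x^-1.
Proof. exact: cosetZV. Qed.

End CentralQuotient.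

(* C_G(g) / Z(G) is taken as the image of C_G(g) in G / Z(G). *)
Definition c_small (G : groupType) (g : G) : Prop :=
  centralizer g = [set zexpg g t * z | t in [set: int] & z in center G] /\
  infinite_cyclic (@cosetZ G @` centralizer g).

(* An abelian group A written additively. *)
Definition additive (A : groupType) (cA : forall x y : A, commute x y) : Type := A.

Section Additive.
Variables (A : groupType) (cA : forall x y : A, commute x y).

HB.instance Definition _ := Choice.on (additive cA).
HB.instance Definition _ := @GRing.isZmodule.Build (additive cA)
  (1 : A) (fun x : A => x^-1) *%g (@mulgA A) cA (@mul1g A) (@mulVg A).

End Additive.

Section DerivedGroup.
Variable G : groupType.

Definition derived_group : Type := {x : G | x \in derived G}.

HB.instance Definition _ := [isSub of derived_group for @sval _ _].
HB.instance Definition _ := [Choice of derived_group by <:].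

Lemma derived_group_closed : group_closed [in derived G].
Proof.
have [d1 dd] := is_subgroup_gen [set [~ x, y] | x in [set: G] & y in [set: G]].
by split=> [|x y]; rewrite !inE //; apply: dd.
Qed.

HB.instance Definition _ := SubChoice_isSubGroup.Build G _ derived_group
  derived_group_closed.

End DerivedGroup.

Section Class2.
Variables (G : groupType) (hG : nilpotent_of_class G 2).

Lemma derived_central (d : G) : derived G d -> center G d.
Proof.
move=> hd x; apply/commgP; apply/eqP.
have : lower_central G 2 [~ d, x] by apply: sub_gen; exists d => //; exists x.
by case: hG => ->.
Qed.

Lemma derived_commg (x y : G) : derived G [~ x, y].
Proof. by apply: sub_gen; exists x => //; exists y. Qed.

Lemma commg_central (x y : G) : center G [~ x, y].
Proof. by apply: derived_central; apply: derived_commg. Qed.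

Lemma quotZ_abelian (u v : quotZ G) : commute u v.
Proof.
rewrite -[u]cosetZ_repr -[v]cosetZ_repr; set x := repr u; set y := repr v.
rewrite /commute !cosetZ_mul; apply/cosetZ_eq.
rewrite invgM -mulgA; have := commg_central y x.
by rewrite /commg /conjg !mulgA.
Qed.

Lemma derived_abelian (a b : derived_group G) : commute a b.
Proof.
apply/val_inj; rewrite !gmulfM.
by apply: derived_central; have := valP a; rewrite inE.
Qed.

(* G / Z(G) and G' as additively written abelian groups. *)
Definition quotZ_add : zmodType := additive quotZ_abelian.
Definition derived_add : zmodType := additive derived_abelian.

Lemma mem_derived_commg (x y : G) : [~ x, y] \in derived G.
Proof. by rewrite inE; apply: derived_commg. Qed.

(* The map (x Z(G), y Z(G)) |-> [x, y]; see [comm_formE]. *)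
Definition comm_form (u v : quotZ_add) : derived_add :=
  exist _ [~ repr (u : quotZ G), repr (v : quotZ G)] (mem_derived_commg _ _).

Lemma commMg (x y z : G) : [~ x * y, z] = [~ x, z] * [~ y, z].
Proof.
rewrite {1}/commg conjMg invgM -mulgA (mulgA x^-1) -/(commg x z).
by rewrite (commg_central x z) mulgA -/(commg y z) (commg_central x z).
Qed.

Lemma commgM (x y z : G) : [~ x, y * z] = [~ x, y] * [~ x, z].
Proof. by rewrite -invgR commMg invgM !invgR (commg_central x z). Qed.

Lemma commg_cosetZ (x x' y y' : G) : cosetZ x = cosetZ x' ->
  cosetZ y = cosetZ y' -> [~ x, y] = [~ x', y'].
Proof.
move=> /cosetZ_eq cx /cosetZ_eq cy.
rewrite -[x'](mulVKg x) -[y'](mulVKg y) commMg commgM.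
have /eqP -> : [~ x, y^-1 * y'] == 1 by apply/commgP/commute_sym/cy.
by have /eqP -> : [~ x^-1 * x', y * (y^-1 * y')] == 1; [exact/commgP/cx | rewrite !mulg1].
Qed.

Lemma comm_formE (x y : G) :
  val (comm_form (cosetZ x) (cosetZ y) : derived_group G) = [~ x, y].
Proof. by apply: commg_cosetZ; apply: cosetZ_repr. Qed.

End Class2.

Arguments comm_form {G} hG u v.
Arguments comm_formE {G} hG x y.

Local Open Scope ring_scope.

Section RingsOfScalars.
Variables (A B : zmodType).

Definition bilinear_map (f : A -> A -> B) : Prop :=
  (forall x y z, f (x + y) z = f x z + f y z) /\
  (forall x y z, f x (y + z) = f x y + f x z).

Definition nondegenerate (f : A -> A -> B) : Prop :=
  (forall a, (forall x, f a x = 0) -> a = 0) /\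
  (forall a, (forall x, f x a = 0) -> a = 0).

(* Every subgroup of B containing the image of f is B. *)
Definition full (f : A -> A -> B) : Prop :=
  smallest (fun H : set B => H 0 /\ forall b c, H b -> H c -> H (b - c))
    [set f x y | x in [set: A] & y in [set: A]] = [set: B].

(* [act] makes the abelian group V a faithful (unitary) R-module. *)
Record faithful_module (R : comPzRingType) (V : zmodType) (act : R -> V -> V)
    : Prop := {
  act_add_vec : forall r v w, act r (v + w) = act r v + act r w;
  act_add_scal : forall r s v, act (r + s) v = act r v + act s v;
  act_mul_scal : forall r s v, act (r * s) v = act r (act s v);
  act_one : forall v, act 1 v = v;
  act_faithful : forall r s, act r =1 act s -> r = s }.

(* R, acting on A by [actA], is a ring of scalars of f. *)
Definition ring_of_scalars (f : A -> A -> B) (R : comPzRingType)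
    (actA : R -> A -> A) : Prop :=
  faithful_module actA /\
  exists actB : R -> B -> B,
    faithful_module actB /\
    forall r x y, f (actA r x) y = actB r (f x y) /\
                  f x (actA r y) = actB r (f x y).

(* R' <= R in End(A): the image of R' in End(A) is contained in that of R. *)
Definition largest_ring_of_scalars (f : A -> A -> B) (R : comPzRingType)
    (actA : R -> A -> A) : Prop :=
  ring_of_scalars f actA /\
  forall (R' : comPzRingType) (actA' : R' -> A -> A),
    ring_of_scalars f actA' -> range actA' `<=` range actA.

End RingsOfScalars.

Section CommForm.
Variables (G : groupType) (hG : nilpotent_of_class G 2).

Lemma comm_form_bilinear : bilinear_map (comm_form hG).
Proof.
have E (u v : quotZ_add hG) :
    u + v = cosetZ (repr (u : quotZ G) * repr (v : quotZ G))%g by [].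
split=> x y z; apply: val_inj.
  rewrite E /=; set u := repr (x : quotZ G); set v := repr (y : quotZ G).
  by rewrite -(commMg hG); apply: (commg_cosetZ hG); rewrite ?cosetZ_repr.
rewrite E /=; set u := repr (y : quotZ G); set v := repr (z : quotZ G).
by rewrite -(commgM hG); apply: (commg_cosetZ hG); rewrite ?cosetZ_repr.
Qed.

Lemma comm_form_nondegenerate : nondegenerate (comm_form hG).
Proof.
have Z (x : G) : (forall y, [~ x, y]%g = 1%g) -> cosetZ x = 0 :> quotZ_add hG.
  move=> h; apply/esym/(cosetZ_eq 1%g); rewrite invg1 mul1g => y.
  by apply/commgP; rewrite h.
split=> a h; rewrite -[a](@cosetZ_repr G); apply: Z => y.
  by rewrite -(comm_formE hG) cosetZ_repr h.
by apply/eqP; rewrite commg1_sym; rewrite -(comm_formE hG) cosetZ_repr h.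
Qed.

Lemma comm_form_full : full (comm_form hG).
Proof.
apply/seteqP; split=> // b _ H [[H0 Hd] HS].
pose K := [set x : G | exists2 c : derived_add hG, H c & val (c : derived_group G) = x].
have: derived G `<=` K.
  apply: gen_min.
    split=> [|x y [c Hc <-] [d Hd' <-]]; first by exists 0.
    by exists (c - d) => //; apply: Hd.
  move=> _ [x _ [y _ <-]]; exists (comm_form hG (cosetZ x) (cosetZ y)).
    by apply: HS; exists (cosetZ x) => //; exists (cosetZ y).
  exact: comm_formE.
move=> /(_ (val (b : derived_group G))) []; last by move=> c Hc /val_inj <-.
by have := valP (b : derived_group G); rewrite inE.
Qed.

End CommForm.

(* R is the largest ring of scalars R(f) of G, f being the commutator map. *)
Definition group_ring_of_scalars (G : groupType) (hG : nilpotent_of_class G 2)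
    (R : comPzRingType) : Prop :=
  exists actA : R -> quotZ_add hG -> quotZ_add hG,
    largest_ring_of_scalars (comm_form hG) actA.

Definition ring_isomorphic (R S : pzRingType) : Prop :=
  exists phi : {rmorphism R -> S}, bijective phi.

Local Close Scope ring_scope.

(* Group words in n variables with coefficients in G. *)
Inductive word (G : Type) (n : nat) : Type :=
  | Var of 'I_n
  | Cst of G
  | Mul of word G n & word G n
  | Inv of word G n.

Fixpoint eval (G : groupType) n (v : n.-tuple G) (w : word G n) : G :=
  match w with
  | Var i => tnth v i
  | Cst g => g
  | Mul w1 w2 => eval v w1 * eval v w2
  | Inv w1 => (eval v w1)^-1
  end.

Definition equation (G : Type) (n : nat) : Type := (word G n * word G n)%type.

Definition solves (G : groupType) n (v : n.-tuple G) (S : seq (equation G n))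
    : bool := all (fun e => eval v e.1 == eval v e.2) S.

Definition e_definable (G : groupType) m (X : set (m.-tuple G)) : Prop :=
  exists (k : nat) (S : seq (equation G (m + k))),
    forall a : m.-tuple G,
      X a <-> exists y : k.-tuple G, solves [tuple of a ++ y] S.

(* [phi] only matters on X. *)
Definition e_interpretable (R : pzRingType) (G : groupType) : Prop :=
  exists (m : nat) (X : set (m.-tuple G)) (phi : m.-tuple G -> R),
    [/\ e_definable X,
        set_surj X [set: R] phi,
        e_definable [set [tuple of ab.1 ++ ab.2] |
          ab in [set ab | [/\ X ab.1, X ab.2 & phi ab.1 = phi ab.2]]],
        e_definable [set [tuple of abc.1.1 ++ abc.1.2 ++ abc.2] |
          abc in [set abc | [/\ X abc.1.1, X abc.1.2, X abc.2
            & phi abc.1.1 + phi abc.1.2 = phi abc.2]%R]] &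
        e_definable [set [tuple of abc.1.1 ++ abc.1.2 ++ abc.2] |
          abc in [set abc | [/\ X abc.1.1, X abc.1.2, X abc.2
            & phi abc.1.1 * phi abc.1.2 = phi abc.2]%R]]].

(* Main.v *)
(** Write A = G/Z(G), B = G' and f : A x A -> B for the commutator form, and let
    c be the image in A of the c-small element g; thus c has infinite order and
    f x c = 0 only for x in Z c.  If r is a scalar, f (r c) c = r (f c c) = 0, so
    r c = n c for an integer n, and f (r x - n x) c = 0 gives r x = n x + m c.
    Then 0 = f (r x) x = m f c x forces m x = k c, and computing r (m x) in two
    ways yields m^2 c = 0, so m = 0: every scalar is an integer.

    The integer t is interpreted by the coset g^t Z(G), inside the centralizer of
    g.  As G is generated by finitely many s_i, being central is a finite system
    of equations.  For a, b, d representing s, t, u we have u = s t if and only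
    if there are y_i with [y_i, g] = [s_i, b] and [y_i, a] = [s_i, d]: the first
    equation makes y_i a substitute for s_i^t, and the second one then reads
    [s_i, g]^(s t) = [s_i, g]^u. *)
From HB Require Import structures.
Require Import Defs.
From mathcomp Require Import all_boot all_algebra.
From mathcomp Require Import boolp classical_sets.

Set Implicit Arguments.
Unset Strict Implicit.
Unset Printing Implicit Defensive.

Import GRing.Theory.
Local Open Scope classical_set_scope.
Local Open Scope ring_scope.

(** * Scalars of an alternating form, and their comparison with the integers *)

Lemma faithful_module_mulrz (R : comPzRingType) (V : zmodType)
    (act : R -> V -> V) (r : R) (v : V) (n : int) :
  faithful_module act -> act r (v *~ n) = act r v *~ n.
Proof.
move=> hact.
have hB (x y : V) : act r (x - y) = act r x - act r y.
  by apply/(addIr (act r y)); rewrite -(act_add_vec hact) !subrK.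
pose h := GRing.isZmodMorphism.Build V V (act r) hB.
pose F : {additive V -> V} := HB.pack (act r) h.
exact: (raddfMz F).
Qed.

Section BilinearMaps.
Variables (A B : zmodType) (f : A -> A -> B).
Hypothesis f_bil : bilinear_map f.

Let f_l (z : A) (x y : A) : f (x - y) z = f x z - f y z.
Proof.
have [fD _] := f_bil; apply/(addIr (f y z)).
by rewrite -fD !subrK.
Qed.

Let f_r (z : A) (x y : A) : f z (x - y) = f z x - f z y.
Proof.
have [_ fD] := f_bil; apply/(addIr (f z y)).
by rewrite -fD !subrK.
Qed.

Lemma bilinear_mulrzl (x y : A) (n : int) : f (x *~ n) y = f x y *~ n.
Proof.
pose h := GRing.isZmodMorphism.Build A B (f ^~ y) (f_l y).
pose F : {additive A -> B} := HB.pack (f ^~ y) h.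
exact: (raddfMz F).
Qed.

Lemma bilinear_mulrzr (x y : A) (n : int) : f x (y *~ n) = f x y *~ n.
Proof.
pose h := GRing.isZmodMorphism.Build A B (f x) (f_r x).
pose F : {additive A -> B} := HB.pack (f x) h.
exact: (raddfMz F).
Qed.

Hypothesis f_alt : forall x, f x x = 0.

Lemma alternating_antisym (x y : A) : f y x = - f x y.
Proof.
have [fDl fDr] := f_bil.
apply/eqP; rewrite -addr_eq0; apply/eqP.
by have := f_alt (x + y); rewrite fDl !fDr !f_alt add0r addr0 addrC.
Qed.

Variable c : A.
Hypothesis c_orth : forall x, f x c = 0 -> exists t : int, x = c *~ t.
Hypothesis c_free : injective (intmul c).

Let c_mulrz_eq0 (n : int) : c *~ n = 0 -> n = 0.
Proof. by move=> h; apply: c_free; rewrite h mulr0z. Qed.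

Lemma scalar_integral (R : comPzRingType) (act : R -> A -> A) (r : R) :
  ring_of_scalars f act -> exists n : int, forall x, act r x = x *~ n.
Proof.
move=> [hA [actB [hB fact]]].
have [fDl _] := f_bil.
have actB0 : actB r 0 = 0.
  by have := faithful_module_mulrz r 0 0 hB; rewrite !mulr0z.
have [n rc] : exists n : int, act r c = c *~ n.
  by apply: c_orth; rewrite (fact r c c).1 f_alt actB0.
exists n => x.
have [m hm] : exists m : int, act r x - x *~ n = c *~ m.
  apply: c_orth.
  by rewrite f_l (fact r x c).1 -(fact r x c).2 rc bilinear_mulrzl bilinear_mulrzr subrr.
have rx : act r x = x *~ n + c *~ m by rewrite -hm addrC subrK.
have [k xk] : exists k : int, x *~ m = c *~ k.
  (* Antisymmetry turns f (m x) c = 0 into f (m c) x = 0, which is f (r x) x = 0 less the vanishing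
     term n f x x. *)
  apply: c_orth; apply/eqP.
  rewrite bilinear_mulrzl alternating_antisym mulNrz oppr_eq0 -bilinear_mulrzl; apply/eqP.
  have := (fact r x x).1; rewrite f_alt actB0 rx fDl (bilinear_mulrzl x) f_alt.
  by rewrite mul0rz add0r.
(* On Z c, which contains m x, the scalar r acts as n, so r (m x) = n m x; additivity gives m (n x +
   m c) instead. *)
have : act r (x *~ m) = x *~ m *~ n.
  by rewrite {1}xk faithful_module_mulrz // rc mulrzAC -xk.
rewrite faithful_module_mulrz // rx mulrzDl -!mulrzA [n * m]mulrC => /eqP.
rewrite -subr_eq0 addrAC subrr add0r => /eqP /c_mulrz_eq0 /eqP.
by rewrite mulf_eq0 orbb => /eqP ->; rewrite mulr0z addr0.
Qed.

Hypothesis f_nondeg : Defs.nondegenerate f.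

(** The action on A is faithful because c has infinite order. If n kills B, then f (n c) x = 0 for
    all x, so n c = 0 by non-degeneracy and again n = 0. *)
Lemma ring_of_scalars_int : ring_of_scalars f (fun (n : int) (x : A) => x *~ n).
Proof.
have faith (V : zmodType) : (forall n : int, (forall v : V, v *~ n = 0) -> n = 0) ->
    faithful_module (fun (n : int) (v : V) => v *~ n).
  move=> hV; split=> [r v w|r s v|r s v|v|r s rs]; rewrite ?mulrzDl ?mulrzDr //.
    by rewrite -mulrzA mulrC.
  apply/eqP; rewrite -subr_eq0; apply/eqP/hV => v.
  by rewrite mulrzBr rs subrr.
split; first by apply: faith => n h; apply: c_mulrz_eq0.
exists (fun n b => b *~ n); split; last first.
  by move=> n x y; rewrite bilinear_mulrzl bilinear_mulrzr.
apply: faith => n h; apply: c_mulrz_eq0; apply: f_nondeg.1 => x.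
by rewrite bilinear_mulrzl.
Qed.

Lemma largest_ring_of_scalars_int :
  largest_ring_of_scalars f (fun (n : int) (x : A) => x *~ n).
Proof.
split; first exact: ring_of_scalars_int.
move=> R act hact _ [r _ <-]; have [n hn] := scalar_integral r hact.
by exists n => //; apply/funext => x.
Qed.

(** Each scalar acts as an integer, unique since c has infinite order; uniqueness makes [phi] a ring
    morphism. It is injective by faithfulness, and surjective because Z is itself a ring of scalars,
    hence contained in the largest one. *)
Lemma largest_ring_of_scalars_iso (R : comPzRingType) (act : R -> A -> A) :
  largest_ring_of_scalars f act -> ring_isomorphic R int.
Proof.
move=> [hact hmax]; have [hA _] := hact.
pose phi r := sval (cid (scalar_integral r hact)).
have phiE r x : act r x = x *~ phi r by rewrite /phi; case: cid.
have phiB : zmod_morphism phi.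
  move=> r s; apply: c_free; rewrite mulrzBr -!phiE.
  by apply/(addIr (act s c)); rewrite -(act_add_scal hA) !subrK.
have phiM : monoid_morphism phi.
  split; first by apply: c_free; rewrite -phiE (act_one hA).
  by move=> r s; apply: c_free; rewrite -phiE (act_mul_scal hA) !phiE -mulrzA mulrC.
pose h1 := GRing.isZmodMorphism.Build R int phi phiB.
pose h2 := GRing.isMonoidMorphism.Build R int phi phiM.
pose F : {rmorphism R -> int} := HB.pack phi h1 h2.
exists F.
have inj : injective phi.
  by move=> r s rs; apply: (act_faithful hA) => x; rewrite !phiE rs.
have surj n : exists r, phi r = n.
  have [|r _ hr] := hmax _ _ ring_of_scalars_int (fun x => x *~ n); first by exists n.
  by exists r; apply: c_free; rewrite -phiE hr.
pose psi n := sval (cid (surj n)).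
have psiK : cancel psi phi by move=> n; rewrite /psi; case: cid.
by exists psi => // r; apply: inj; apply: psiK.
Qed.

End BilinearMaps.

(** The map onto S is followed by the inverse isomorphism; the domain and the three preimages stay
    the same sets. *)
Lemma e_interpretable_iso (R S : pzRingType) (G : groupType) :
  ring_isomorphic R S -> e_interpretable S G -> e_interpretable R G.
Proof.
move=> [F [psi FK psiK]] [m [X [phi [dX surj dE dD dM]]]].
have psi_inj := can_inj psiK.
have psiD a b : psi a + psi b = psi (a + b).
  by apply: (can_inj FK); rewrite rmorphD !psiK.
have psiM a b : psi a * psi b = psi (a * b).
  by apply: (can_inj FK); rewrite rmorphM !psiK.
exists m, X, (psi \o phi); split=> //.
- move=> r _; have [a Xa ha] := surj (F r) I.
  by exists a => //=; rewrite ha FK.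
- congr (e_definable [set _ | _ in _]): dE; apply/seteqP.
  by split=> ab [Xa Xb h]; split=> //=; [rewrite h | apply: psi_inj].
- congr (e_definable [set _ | _ in _]): dD; apply/seteqP.
  by split=> abc [Xa Xb Xc h]; split=> //=; [rewrite psiD h | apply: psi_inj; rewrite -psiD].
- congr (e_definable [set _ | _ in _]): dM; apply/seteqP.
  by split=> abc [Xa Xb Xc h]; split=> //=; [rewrite psiM h | apply: psi_inj; rewrite -psiM].
Qed.

(** * Concatenated tuples and systems of equations for centrality *)

Section TupleCat.
Variable T : Type.

Lemma cat_tuple_inj m n (a a' : m.-tuple T) (b b' : n.-tuple T) :
  [tuple of a ++ b] = [tuple of a' ++ b'] -> a = a' /\ b = b'.
Proof.
move=> h; split; apply: eq_from_tnth => i.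
  by rewrite -(tnth_lshift a b) h tnth_lshift.
by rewrite -(tnth_rshift a b) h tnth_rshift.
Qed.

Lemma cat_tuple_surj m n (t : (m + n).-tuple T) :
  exists (a : m.-tuple T) (b : n.-tuple T), t = [tuple of a ++ b].
Proof.
exists [tuple tnth t (lshift n i) | i < m], [tuple tnth t (rshift m i) | i < n].
apply: eq_from_tnth => i; case: (split_ordP i) => j ->.
  by rewrite tnth_lshift tnth_mktuple.
by rewrite tnth_rshift tnth_mktuple.
Qed.

End TupleCat.

Section EDefinable.
Variable G : groupType.

(** A concatenation determines its parts, so a system may be checked on pairs of tuples rather than
    on members of the image. *)
Lemma e_definable_cat2 m n k (P : set (m.-tuple G * n.-tuple G))
    (S : seq (equation G (m + n + k))) :
  (forall a b, P (a, b) <->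
     exists y : k.-tuple G, solves [tuple of [tuple of a ++ b] ++ y] S) ->
  e_definable [set [tuple of ab.1 ++ ab.2] | ab in P].
Proof.
move=> hP; exists k, S => t; have [a [b ->]] := cat_tuple_surj t.
split=> [[[a' b'] Pab /cat_tuple_inj [aa bb]]|/hP Pab]; last by exists (a, b).
by apply/hP; rewrite -aa -bb.
Qed.

Lemma e_definable_cat3 m n p k (P : set (m.-tuple G * n.-tuple G * p.-tuple G))
    (S : seq (equation G (m + (n + p) + k))) :
  (forall a b c, P (a, b, c) <->
     exists y : k.-tuple G, solves [tuple of [tuple of a ++ b ++ c] ++ y] S) ->
  e_definable [set [tuple of abc.1.1 ++ abc.1.2 ++ abc.2] | abc in P].
Proof.
move=> hP; exists k, S => t.
have [a [bc ->]] := cat_tuple_surj t; have [b [c ->]] := cat_tuple_surj bc.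
split=> [[[[a' b'] c'] Pabc]|/hP Pabc]; last by exists (a, b, c).
move=> /cat_tuple_inj [aa /cat_tuple_inj [bb cc]].
by apply/hP; rewrite -aa -bb -cc.
Qed.

(** Bracketed so that its evaluation unfolds to the group commutator. *)
Definition commW n (u v : word G n) : word G n :=
  Mul (Defs.Inv u) (Mul (Defs.Inv v) (Mul u v)).

Definition commutes_eq n (u v : word G n) : equation G n := (commW u v, Cst n 1%g).

(** When [s] generates G, these finitely many equations express centrality. *)
Definition central_eqs n (s : seq G) (u : word G n) : seq (equation G n) :=
  [seq commutes_eq u (Cst n x) | x <- s].

Lemma solves_cons n (a : n.-tuple G) (e : equation G n) (S : seq (equation G n)) :
  solves a (e :: S) = (eval a e.1 == eval a e.2) && solves a S.
Proof. by []. Qed.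

Lemma solves_enum n k (a : n.-tuple G) (F : 'I_k -> equation G n) :
  solves a [seq F i | i <- enum 'I_k] <-> forall i, eval a (F i).1 = eval a (F i).2.
Proof.
rewrite /solves all_map; split=> [/allP h i|h]; last by apply/allP => i _; apply/eqP.
by apply/eqP/(h i)/mem_enum.
Qed.

Lemma commutes_eqP n (a : n.-tuple G) (u v : word G n) :
  reflect (commute (eval a u) (eval a v))
    (eval a (commutes_eq u v).1 == eval a (commutes_eq u v).2).
Proof. exact: commgP. Qed.

(** The elements commuting with x form a subgroup, which is all of G once it contains [s]. *)
Lemma center_gen (s : seq G) (x : G) : gen [set` s] = [set: G] ->
  center G x <-> {in s, forall u, commute x u}.
Proof.
move=> sG; split=> [cx u _|xs u]; first exact: cx.
have : gen [set` s] u by rewrite sG.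
apply: gen_min u => //; split=> [|u v xu xv]; first exact: commute1.
by apply: commuteM => //; apply: commuteV.
Qed.

Lemma solves_central n (s : seq G) (a : n.-tuple G) (u : word G n) :
  gen [set` s] = [set: G] ->
  solves a (central_eqs s u) <-> center G (eval a u).
Proof.
move=> sG; rewrite /solves all_map (center_gen _ sG).
split=> [/allP h x xs|h]; first exact/(commutes_eqP a u (Cst n x))/h.
by apply/allP => x xs; apply/commutes_eqP/h.
Qed.

End EDefinable.

(** * The commutator form at a c-small element, and the interpretation of Z *)

Section CSmall.
Variables (G : groupType) (hG : nilpotent_of_class G 2).
Local Notation A := (quotZ_add hG).
Local Notation f := (comm_form hG).

Let pi (x : G) : A := cosetZ x.

Let piM x y : pi (x * y)%g = pi x + pi y.
Proof. exact/esym/cosetZ_mul. Qed.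

Let piV x : pi (x^-1)%g = - pi x.
Proof. exact/esym/cosetZ_inv. Qed.

Let pi_eq0 x : pi x = 0 <-> center G x.
Proof.
have := cosetZ_eq 1%g x; rewrite invg1 mul1g => <-.
by split=> /esym.
Qed.

Let piX x (t : int) : pi (zexpg x t) = pi x *~ t.
Proof.
have nat_case n : pi (x ^+ n)%g = pi x *+ n.
  by elim: n => [|n IH]; rewrite ?expg0 ?expgS ?piM ?IH ?mulrS.
case: t => n; first exact: nat_case.
by rewrite /= piV nat_case NegzE mulrNz.
Qed.

Let f_comm x y x' y' :
  f (pi x) (pi y) = f (pi x') (pi y') <-> [~ x, y]%g = [~ x', y']%g.
Proof.
by rewrite -!(comm_formE hG); split=> [->|/val_inj].
Qed.

Let f_commute x y : f (pi x) (pi y) = 0 <-> commute x y.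
Proof.
split=> [h|/commgP/eqP h].
  by apply/commgP; rewrite -(comm_formE hG) -/(pi x) -/(pi y) h.
by apply: val_inj; rewrite comm_formE h.
Qed.

Lemma comm_form_alternating (u : A) : f u u = 0.
Proof. by rewrite -[u]cosetZ_repr; apply/f_commute. Qed.

Variables (g : G) (hg : c_small g).
Local Notation c := (cosetZ g : A).

(** A representative of u centralizes g, hence is g^t z with z central, and z vanishes modulo the
    center. *)
Lemma c_small_orth (u : A) : f u c = 0 -> exists t : int, u = c *~ t.
Proof.
rewrite -[u]cosetZ_repr => /f_commute; set x := repr _ => xg.
have [cg _] := hg; have : centralizer g x by [].
rewrite cg => -[t _ [z /pi_eq0 cz <-]]; exists t.
by rewrite -/(pi _) piM cz addr0 piX.
Qed.

(** C-smallness provides some generator h of infinite order, not c itself. But h = k c, so n c = 0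
    forces n h = 0 and n = 0. *)
Lemma c_small_free : injective (intmul c).
Proof.
suff c0 (n : int) : c *~ n = 0 -> n = 0.
  move=> s t st; apply/eqP; rewrite -subr_eq0; apply/eqP/c0.
  by rewrite mulrzBr st subrr.
have [_ [h hC h_inj]] := hg.
have zexpgE (t : int) : zexpg h t = (h : A) *~ t.
  have nat_case n' : (h ^+ n')%g = (h : A) *+ n'.
    by elim: n' => [|n' IH]; rewrite ?expg0 ?mulr0n // expgS mulrS IH.
  by case: t => n'; rewrite /= ?NegzE nat_case ?mulrNz.
move=> cn; apply: h_inj; rewrite !zexpgE mulr0z.
have [x xg xh] : (@cosetZ G @` centralizer g) h.
  by rewrite hC; exists 1 => //; rewrite zexpgE.
have [k hk] : exists k : int, (h : A) = c *~ k.
  by apply: c_small_orth; rewrite -xh; apply/f_commute.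
by rewrite hk mulrzAC cn mul0rz.
Qed.

Lemma e_interpretable_int : finitely_generated G -> e_interpretable int G.
Proof.
move=> [s sG].
have bil := comm_form_bilinear hG.
pose e (a : 1.-tuple G) := tnth a ord0.
pose X : set (1.-tuple G) := [set a | commute (e a) g].
(* The default 0 is taken only outside [X]; on [X] the exponent exists and is unique. *)
pose phi (a : 1.-tuple G) : int := xget 0 [set t | pi (e a) = c *~ t].
have phiE a : X a -> pi (e a) = c *~ phi a.
  by move=> /f_commute/c_small_orth h; rewrite /phi; case: xgetP => // /forallNP; case.
have phi_eq a (t : int) : X a -> phi a = t <-> pi (e a) = c *~ t.
  by move=> /phiE ->; split=> [->|/c_small_free].
have scal (x : G) (t : int) : f (pi x) (c *~ t) = f (pi x) c *~ t.
  exact: bilinear_mulrzr.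
have solves_X n (v : n.-tuple G) w (a : 1.-tuple G) : eval v w = e a ->
    (eval v (commutes_eq w (Cst n g)).1 == eval v (commutes_eq w (Cst n g)).2) =
    `[< X a >].
  by move=> va; apply/(commutes_eqP v w (Cst n g))/asboolP; rewrite va.
exists 1, X, phi; split.
- exists 0%N, [:: commutes_eq (Var G (lshift 0 ord0)) (Cst _ g)] => a.
  split=> [Xa|[y]]; [exists [tuple]|]; rewrite solves_cons andbT.
    by rewrite (solves_X _ _ _ a) /= ?tnth_lshift //; apply/asboolP.
  by rewrite (solves_X _ _ _ a) /= ?tnth_lshift // => /asboolP.
- move=> t _.
  have Xt : X [tuple zexpg g t].
    rewrite /X /= /e tnth0; apply/f_commute.
    by rewrite piX bilinear_mulrzl // comm_form_alternating mul0rz.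
  by exists [tuple zexpg g t] => //; apply/phi_eq => //; rewrite /e tnth0 piX.
(* Equality: a^-1 b is central. No auxiliary unknowns occur. *)
- pose a : word G (1 + 1 + 0) := Var G (lshift 0 (lshift 1 ord0)).
  pose b : word G (1 + 1 + 0) := Var G (lshift 0 (rshift 1 ord0)).
  pose S := [:: commutes_eq a (Cst _ g), commutes_eq b (Cst _ g) &
                central_eqs s (Mul (Defs.Inv a) b)].
  apply: (@e_definable_cat2 _ _ _ _ _ S) => u v.
  have main (y : 0.-tuple G) : solves [tuple of [tuple of u ++ v] ++ y] S <->
      [/\ X u, X v & phi u = phi v].
    have Ea : eval [tuple of [tuple of u ++ v] ++ y] a = e u by rewrite /= !tnth_lshift.
    have Eb : eval [tuple of [tuple of u ++ v] ++ y] b = e v.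
      by rewrite /= tnth_lshift tnth_rshift.
    rewrite !solves_cons (solves_X _ _ _ u) // (solves_X _ _ _ v) //.
    have C := solves_central [tuple of [tuple of u ++ v] ++ y] (Mul (Defs.Inv a) b) sG.
    have D : X u -> X v -> center G (eval [tuple of [tuple of u ++ v] ++ y]
        (Mul (Defs.Inv a) b)) <-> phi u = phi v.
      move=> Xu Xv; cbn [eval]; rewrite Ea Eb -pi_eq0 piM piV phi_eq // (phiE _ Xv).
      by split=> [/eqP|->]; rewrite addrC ?subrr // subr_eq0 => /eqP.
    split=> [/and3P [/asboolP Xu /asboolP Xv /C /D]|[Xu Xv /D h]]; first by split; auto.
    by apply/and3P; split; [exact/asboolP|exact/asboolP|apply/C; auto].
  by split=> [h|[y /main //]]; exists [tuple]; apply/main.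
(* Addition: d^-1 a b is central. *)
- pose n := (1 + (1 + 1) + 0)%N.
  pose a : word G n := Var G (lshift 0 (lshift 2 ord0)).
  pose b : word G n := Var G (lshift 0 (rshift 1 (lshift 1 ord0))).
  pose d : word G n := Var G (lshift 0 (rshift 1 (rshift 1 ord0))).
  pose S := [:: commutes_eq a (Cst _ g), commutes_eq b (Cst _ g), commutes_eq d (Cst _ g) &
                central_eqs s (Mul (Defs.Inv d) (Mul a b))].
  apply: (@e_definable_cat3 _ _ _ _ _ _ S) => u v w.
  have main (y : 0.-tuple G) : solves [tuple of [tuple of u ++ v ++ w] ++ y] S <->
      [/\ X u, X v, X w & phi u + phi v = phi w].
    set t := [tuple of _ ++ y].
    have Ea : eval t a = e u by rewrite /= !tnth_lshift.
    have Eb : eval t b = e v by rewrite /= tnth_lshift tnth_rshift tnth_lshift.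
    have Ed : eval t d = e w by rewrite /= tnth_lshift !tnth_rshift.
    rewrite !solves_cons (solves_X _ _ _ u) // (solves_X _ _ _ v) // (solves_X _ _ _ w) //.
    have C := solves_central t (Mul (Defs.Inv d) (Mul a b)) sG.
    have D : X u -> X v -> X w ->
        center G (eval t (Mul (Defs.Inv d) (Mul a b))) <-> phi u + phi v = phi w.
      move=> Xu Xv Xw; cbn [eval]; rewrite Ea Eb Ed -pi_eq0 !piM piV !phiE // -mulrzDr.
      split=> [/eqP|->]; last by rewrite addrC subrr.
      by rewrite addrC subr_eq0 => /eqP/c_small_free.
    split=> [/and4P [/asboolP Xu /asboolP Xv /asboolP Xw /C /D]|[Xu Xv Xw /D h]].
      by split; auto.
    by apply/and4P; split; [exact/asboolP|exact/asboolP|exact/asboolP|apply/C; auto].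
  by split=> [h|[y /main //]]; exists [tuple]; apply/main.
(* Multiplication: one unknown per generator, placed after the three arguments, hence the shift by
   3. *)
- pose k := size s; pose n := (1 + (1 + 1) + k)%N.
  pose a : word G n := Var G (lshift k (lshift 2 ord0)).
  pose b : word G n := Var G (lshift k (rshift 1 (lshift 1 ord0))).
  pose d : word G n := Var G (lshift k (rshift 1 (rshift 1 ord0))).
  pose z i : word G n := Var G (rshift 3 i).
  pose x i := tnth (in_tuple s) i.
  pose S1 := [seq (commW (z i) (Cst n g), commW (Cst n (x i)) b) | i <- enum 'I_k].
  pose S2 := [seq (commW (z i) a, commW (Cst n (x i)) d) | i <- enum 'I_k].
  pose S := [:: commutes_eq a (Cst _ g), commutes_eq b (Cst _ g), commutes_eq d (Cst _ g) &
                S1 ++ S2].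
  apply: (@e_definable_cat3 _ _ _ _ _ _ S) => u v w.
  have main (y : k.-tuple G) : solves [tuple of [tuple of u ++ v ++ w] ++ y] S <->
      [/\ X u, X v, X w & forall i : 'I_k,
         [~ tnth y i, g]%g = [~ x i, e v]%g /\ [~ tnth y i, e u]%g = [~ x i, e w]%g].
    set t := [tuple of _ ++ y].
    have Ea : eval t a = e u by rewrite /= !tnth_lshift.
    have Eb : eval t b = e v by rewrite /= tnth_lshift tnth_rshift tnth_lshift.
    have Ed : eval t d = e w by rewrite /= tnth_lshift !tnth_rshift.
    have Ez i : eval t (z i) = tnth y i by rewrite /= tnth_rshift.
    rewrite !solves_cons (solves_X _ _ _ u) // (solves_X _ _ _ v) // (solves_X _ _ _ w) //.
    rewrite /solves all_cat.
    split=> [/and5P [/asboolP Xu /asboolP Xv /asboolP Xw /solves_enum h1 /solves_enum h2]|].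
      by split=> // i; rewrite -Ez -Ea -Eb -Ed; split; [exact: h1|exact: h2].
    move=> [Xu Xv Xw h]; apply/and5P; split; try exact/asboolP.
      by apply/solves_enum => i; have [h1 _] := h i; rewrite -Ez -Eb in h1.
    by apply/solves_enum => i; have [_ h2] := h i; rewrite -Ez -Ea -Ed in h2.
  split=> [[Xu Xv Xw uvw]|[y /main [Xu Xv Xw h]]].
    (* The witness y_i is the generator to the power [phi v]; bilinearity then gives both
       equations. *)
    exists [tuple zexpg (x i) (phi v) | i < k]; apply/main; split=> // i.
    rewrite tnth_mktuple -!f_comm piX (phiE _ Xu) (phiE _ Xv) (phiE _ Xw).
    rewrite !(bilinear_mulrzl bil) !scal. split=> //.
    by rewrite -mulrzA uvw.
  suff uvw : phi u * phi v = phi w by split.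
  (* It suffices that g to the power [phi u * phi v - phi w] is central, which is tested on the
     generators. *)
  apply: c_small_free; apply/eqP; rewrite -subr_eq0 -mulrzBr -piX; apply/eqP.
  apply/pi_eq0/(center_gen _ sG) => q qs; have /tnthP [i ->] : q \in in_tuple s by [].
  apply/commute_sym/f_commute; rewrite piX scal mulrzBr.
  have [/f_comm h1 /f_comm h2] := h i; move: h2; rewrite (phiE _ Xu) (phiE _ Xw) !scal.
  rewrite [f _ c]h1 (phiE _ Xv) scal -mulrzA mulrC => ->.
  exact: subrr.
Qed.

End CSmall.

Theorem proposition4p5 (G : groupType) (hfg : finitely_generated G)
    (hG : nilpotent_of_class G 2) (hc : exists g : G, c_small g) :
  (exists R : comPzRingType, group_ring_of_scalars hG R) /\
  (forall R : comPzRingType, group_ring_of_scalars hG R ->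
     ring_isomorphic R int /\ e_interpretable R G).
Proof.
have [g hg] := hc.
have [bil nondeg] := (comm_form_bilinear hG, comm_form_nondegenerate hG).
have [alt orth] := (@comm_form_alternating _ hG, @c_small_orth _ hG _ hg).
have free := @c_small_free _ hG _ hg.
(* The ring left to unification is Z, acting by integer multiples. *)
split; first by eexists; eexists; exact: (largest_ring_of_scalars_int bil alt orth free nondeg).
move=> R [act hact].
have iso := largest_ring_of_scalars_iso bil alt orth free nondeg hact.
by split=> //; apply: e_interpretable_iso iso (e_interpretable_int hG hg hfg).
Qed.
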